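(* Fix positive integers $r,k<\infty$. For any $r$-coloring $C:\mathbb{Q}_+\to\{1,\dots,r\}$ of the positive rationals, there exist $x_1,\dots,x_k\in\mathbb{Q}_+$ (not necessarily distinct) such that the set \[\left\{\sum_{j=1}^{\ell}\prod_{i\in I_j}x_i \;:\; \ell\ge 1,\ I_1,\dots,I_\ell\subset[k]\text{ non-empty and pairwise disjoint}\right\}\] is monochromatic under $C$.
   Context: $\mathbb{Q}_+$ denotes the set of positive rationals (zero excluded), and $[k]=\{1,\dots,k\}$. *)

(* Defs.v *)
From HB Require Import structures.
From mathcomp Require Import all_boot all_order all_algebra.
Set Implicit Arguments.
Unset Strict Implicit.
Unset Printing Implicit Defensive.
Import Order.TTheory GRing.Theory Num.Theory.
Local Open Scope ring_scope.

Definition posrat := {q : rat | 0 < q}.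

Definition monochromatic (T K : Type) (C : T -> K) (A : T -> Prop) : Prop :=
  exists c : K, forall q : T, A q -> C q = c.

Definition block_sum (k l : nat) (x : 'I_k -> posrat)
    (I : 'I_l -> {set 'I_k}) : rat :=
  \sum_(j < l) \prod_(i in I j) val (x i).

(* The index sets are a family I_0, ..., I_{l-1}. The condition is put on
   [val q] because bigops live in [rat]; by [block_sum_gt0] below, no sum is
   lost by letting q range over [posrat]. *)
Definition sums_of_disjoint_products (k : nat) (x : 'I_k -> posrat)
    (q : posrat) : Prop :=
  exists (l : nat) (I : 'I_l -> {set 'I_k}),
    [/\ (1 <= l)%N,
        forall j : 'I_l, I j != set0,
        forall j j' : 'I_l, j != j' -> [disjoint I j & I j']
      & val q = block_sum x I].

Lemma block_sum_gt0 (k l : nat) (x : 'I_k -> posrat)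
    (I : 'I_l -> {set 'I_k}) : (1 <= l)%N -> 0 < block_sum x I.
Proof.
case: l I => // l I _; rewrite /block_sum big_ord_recl ltr_wpDr //.
  by apply: sumr_ge0 => j _; apply: prodr_ge0 => i _; exact/ltW/(valP (x i)).
by apply: prodr_gt0 => i _; exact: (valP (x i)).
Qed.

(* Main.v *)
Require Import Defs.
From mathcomp Require Import all_boot all_order all_algebra.
From mathcomp Require Import ring zify.
Set Implicit Arguments.
Unset Strict Implicit.
Unset Printing Implicit Defensive.
Import Order.TTheory GRing.Theory Num.Theory.
Local Open Scope ring_scope.

(* It suffices to find long sequences t_0, ..., t_(N-1) of positive rationals
   such that a sum of disjoint products has the colour of the one product that
   contains the largest index: finite unions (Hales-Jewett) then give disjoint
   blocks of indices all of whose unions have products of one colour, and x_i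
   is the product over the i-th block.

   Such a sequence is extended by one term as follows.  Choose the first N
   terms so that all their rescalings by finitely many d are good, and then
   look for x and one of these d with C (p d^j x + f d) = C (p d^j x) for all
   j <= N, where p and the polynomials f (with f 0 = 0) depend on the terms
   already chosen.  The new sequence is d t_0, ..., d t_(N-1), x.  To treat the
   exponents j one at a time, starting with the largest, write d as a product
   of scales, one for each j, and give x the matching negative powers of these
   scales, so that the scale belonging to j cancels in d^j x.  Each step is then
   an instance of the polynomial van der Waerden theorem, whose scale comes
   from a finite set known beforehand. *)

(* Lexicographic induction on (w (D - 1), ..., w 0). *)
Lemma lex_ind (D : nat) (P : (nat -> nat) -> Prop) :
  (forall w,
     (forall w' k0, (k0 < D)%N -> (w' k0 < w k0)%N ->
        (forall k, (k0 < k < D)%N -> (w' k <= w k)%N) -> P w') -> P w) ->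
  forall w, P w.
Proof.
elim: D P => [|D IH] P HP w; first by apply: HP.
have [n] := ubnP (w D); elim: n w => // n IHn; apply: IH => w IHw lewn.
apply: HP => w' k0; rewrite ltnS leq_eqVlt => /predU1P[-> | ltk0] lt0 le0.
  by apply: IHn; apply: leq_trans lt0 _.
apply: (IHw w' k0) => // [k /andP[k0k kD]|].
  by apply: le0; rewrite k0k ltnW.
by apply: leq_ltn_trans lewn; rewrite le0 // ltk0 /=.
Qed.

(** * Polynomial van der Waerden theorem, by colour focusing and PET induction *)

Section PolynomialVanDerWaerden.

Variable R : idomainType.

(** The finitely many candidates [w o], [d o] are fixed before the colouring, so a point can be
    coloured by the colours of finitely many of its translates. *)
Definition recurrent (F : seq {poly R}) : Prop :=
  forall T : finType, exists (O : finType) (w : O -> R) (d : O -> nat),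
    (forall o, (0 < d o)%N) /\
    forall c : R -> T, exists o,
      forall p, p \in F -> c (w o + p.[(d o)%:R]) = c (w o).

(** Once the base point is moved back by [p1.[e]], the translate by [p.[e + h]] is the old translate
    by [p.[h]] plus [(pet_shift p1 p h).[e]]. *)
Definition pet_shift (p1 : {poly R}) (p : {poly R}) (h : nat) : {poly R} :=
  p \Po ('X + (h%:R)%:P) - (p.[h%:R])%:P - p1.

Lemma horner_pet_shift p1 p h x :
  (pet_shift p1 p h).[x] = p.[x + h%:R] - p.[h%:R] - p1.[x].
Proof. by rewrite /pet_shift !hornerE horner_comp !hornerE. Qed.

(* Walters' colour focusing: the step d is found together with a point whose
   translates by p.[d], for the d of a list, have s colours other than its own,
   one for each d. *)
Lemma colour_focusing (F : seq {poly R}) (p1 : {poly R}) :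
  (forall p, p \in F -> p.[0] = 0) -> p1 \in F ->
  (forall hs : seq nat, recurrent [seq pet_shift p1 p h | p <- F, h <- hs]) ->
  forall (T : finType) (s : nat),
  exists (O : finType) (a : O -> R) (ds : O -> seq nat),
    (forall o d, d \in ds o -> (0 < d)%N) /\
    forall c : R -> T, exists o,
      (exists2 d, d \in ds o &
         forall p, p \in F -> c (a o + p.[d%:R]) = c (a o)) \/
      [/\ size (ds o) = s,
          forall d p, d \in ds o -> p \in F ->
            c (a o + p.[d%:R]) = c (a o + p1.[d%:R])
        & uniq (c (a o) :: [seq c (a o + p1.[d%:R]) | d <- ds o])].
Proof.
move=> F0 Fp1 IH T; elim=> [|s [O [a [ds [ds_gt0 IHs]]]]].
  exists unit, (fun=> 0), (fun=> [::]); split=> // c; exists tt.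
  by right; split.
(* The step [0] stands for the old focus, which becomes one more focused colour. *)
pose hs := 0%N :: flatten [seq ds o | o <- enum O].
pose offs := [seq a o + (pd : {poly R} * nat).1.[pd.2%:R] |
   o <- enum O, pd <- [seq (p, d) | p <- F, d <- hs]].
have mem_hs o d : d \in 0%N :: ds o -> d \in hs.
  rewrite !inE => /predU1P[->|dds]; rewrite ?eqxx //.
  by apply/orP; right; apply/flattenP; exists (ds o); rewrite ?map_f ?mem_enum.
have mem_offs o p d : p \in F -> d \in 0%N :: ds o -> a o + p.[d%:R] \in offs.
  move=> Fp /mem_hs dds; pose v (o : O) (pd : {poly R} * nat) := a o + pd.1.[pd.2%:R].
  apply: (@allpairs_f _ _ _ v _ _ o (p, d)); first by rewrite mem_enum.
  exact: (allpairs_f pair).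
have [O' [b [e [e_gt0 IH']]]] := IH hs {ffun 'I_(size offs) -> T}.
(* [true] keeps an old success, translated; [false] is the new focus, moved back by [p1]. *)
exists (O' * O * bool)%type.
exists (fun u => if u.2 then b u.1.1 + a u.1.2
   else b u.1.1 + a u.1.2 - p1.[(e u.1.1)%:R]).
exists (fun u => if u.2 then ds u.1.2
   else [seq (e u.1.1 + d)%N | d <- 0%N :: ds u.1.2]).
split=> [[[o' o] []] d /=|c]; first exact: ds_gt0.
  have := e_gt0 o'; rewrite inE => e0 /predU1P[->|/mapP[d' _ ->]]; lia.
have [o' Ho'] := IH' (fun y => [ffun i : 'I_(size offs) => c (y + offs`_i)]).
have [o [[d dds Hd]|[sz mono un]]] := IHs (fun y => c (b o' + y)).
  by exists (o', o, true); left; exists d => //= p Fp; rewrite -!addrA Hd.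
set a' := b o' + a o - p1.[(e o')%:R].
have key p d : p \in F -> d \in 0%N :: ds o ->
    c (a' + p.[(e o' + d)%:R]) = c (b o' + (a o + p.[d%:R])).
  move=> Fp dds; have offs_pd := mem_offs o p d Fp dds.
  have /Ho'/ffunP : pet_shift p1 p d \in [seq pet_shift p1 p h | p <- F, h <- hs].
    by apply: (allpairs_f (pet_shift p1)) => //; apply: mem_hs dds.
  have lt_i : (index (a o + p.[d%:R])%R offs < size offs)%N by rewrite index_mem.
  move=> /(_ (Ordinal lt_i)); rewrite !ffunE /= nth_index //.
  rewrite horner_pet_shift => <-; congr c; rewrite /a' natrD; ring.
have key' p d : p \in F -> d \in 0%N :: ds o ->
    c (a' + p.[(e o' + d)%:R]) = c (b o' + (a o + p1.[d%:R])).
  move=> Fp dds; rewrite key //; move: dds; rewrite inE => /predU1P[->|dds].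
    by rewrite !F0.
  exact: mono.
have un' : uniq [seq c (b o' + (a o + p1.[d%:R])) | d <- 0%N :: ds o].
  by move: un; rewrite /= F0 // addr0.
have [/mapP[d dds Ed]|c'n] :=
    boolP (c a' \in [seq c (b o' + (a o + p1.[d%:R])) | d <- 0%N :: ds o]).
  exists (o', o, false); left; exists (e o' + d)%N; last first.
    by move=> p Fp /=; rewrite key' // -Ed.
  by apply/mapP; exists d.
exists (o', o, false); right; split.
- by rewrite size_map /= sz.
- move=> d p /mapP[d' dds ->] Fp /=.
  by rewrite !key'.
rewrite [X in uniq X](_ : _ =
    c a' :: [seq c (b o' + (a o + p1.[d%:R])) | d <- 0%N :: ds o]).
  by rewrite cons_uniq c'n.
congr cons; rewrite -map_comp; apply/eq_in_map => d dds /=.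
exact: key'.
Qed.

Lemma recurrent_nil : recurrent [::].
Proof.
by move=> T; exists unit, (fun=> 0), (fun=> 1%N); split=> // c; exists tt.
Qed.

Lemma recurrent_filter (F : seq {poly R}) :
  recurrent [seq p <- F | p != 0] -> recurrent F.
Proof.
move=> H T; have [O [w [d [d_gt0 Hc]]]] := H T.
exists O, w, d; split=> // c; have [o Ho] := Hc c; exists o => p Fp.
have [->|p0] := eqVneq p 0; first by rewrite horner0 addr0.
by apply: Ho; rewrite mem_filter p0.
Qed.

(** For [s = #|T|], the second alternative of focusing would need [#|T| + 1] colours. *)
Lemma recurrent_of_shifts (F : seq {poly R}) (p1 : {poly R}) :
  (forall p, p \in F -> p.[0] = 0) -> p1 \in F ->
  (forall hs : seq nat, recurrent [seq pet_shift p1 p h | p <- F, h <- hs]) ->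
  recurrent F.
Proof.
move=> F0 Fp1 IH T.
have [O [a [ds [ds_gt0 Hc]]]] := colour_focusing F0 Fp1 IH T #|T|.
exists {o : O & 'I_(size (ds o))}, (fun u => a (tag u)).
exists (fun u => nth 0%N (ds (tag u)) (nat_of_ord (tagged u))); split=> [[o i] /=|c].
  by apply: (ds_gt0 o); rewrite mem_nth.
have [o [[d dds Hd]|[sz _ un]]] := Hc c.
  have lt_i : (index d (ds o) < size (ds o))%N by rewrite index_mem.
  exists (Tagged (fun o => 'I_(size (ds o))) (Ordinal lt_i)) => p Fp /=.
  by rewrite nth_index // Hd.
by have := max_card (mem (c (a o) :: [seq c (a o + p1.[d%:R]) | d <- ds o]));
  rewrite (card_uniqP un) /= size_map sz ltnn.
Qed.

(** The PET weight, indexed by size, i.e. degree plus one. It counts leading coefficients because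
    all shifts of a [p] of higher degree than [p1] share one. *)
Definition lead_count (F : seq {poly R}) (k : nat) : nat :=
  size (undup [seq lead_coef p | p : {poly R} <- F & size p == k]).

Lemma lead_count_sub (F G : seq {poly R}) (k : nat) :
  (forall p, p \in F -> size p = k ->
     exists2 q, q \in G & size q = k /\ lead_coef p = lead_coef q) ->
  (lead_count F k <= lead_count G k)%N.
Proof.
move=> H; apply: uniq_leq_size (undup_uniq _) _ => x.
rewrite !mem_undup => /mapP[p]; rewrite mem_filter => /andP[/eqP sp Fp] ->.
have [q Gq [sq ->]] := H p Fp sp; apply: map_f.
by rewrite mem_filter sq eqxx.
Qed.

Lemma size_shift (p : {poly R}) (a : R) : size (p \Po ('X + a%:P)) = size p.
Proof. by rewrite size_comp_poly2 // size_XaddC. Qed.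

Lemma lead_coef_shift (p : {poly R}) (a : R) :
  lead_coef (p \Po ('X + a%:P)) = lead_coef p.
Proof. by rewrite lead_coef_comp ?size_XaddC // lead_coefXaddC expr1n mulr1. Qed.

Lemma size_gt1_root0 (p : {poly R}) : p != 0 -> p.[0] = 0 -> (1 < size p)%N.
Proof.
move=> p0 r0; rewrite ltnNge; apply: contra p0 => /size1_polyC Ep.
by move: r0; rewrite Ep hornerC => ->.
Qed.

Lemma size_lead_subr (p q : {poly R}) (k : nat) :
  size p = k -> (size q < k)%N ->
  size (p - q) = k /\ lead_coef (p - q) = lead_coef p.
Proof.
by move=> <- lt; rewrite size_polyDl ?lead_coefDl // size_polyN.
Qed.

Lemma size_lead_pet_shift (p1 p : {poly R}) (h : nat) :
  (1 < size p1)%N -> (size p1 < size p)%N ->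
  size (pet_shift p1 p h) = size p /\ lead_coef (pet_shift p1 p h) = lead_coef p.
Proof.
move=> p1_gt1 lt; rewrite /pet_shift -addrA -opprD.
rewrite -[lead_coef p](lead_coef_shift p h%:R).
apply: size_lead_subr; first exact: size_shift.
apply: leq_ltn_trans lt; apply: leq_trans (size_polyD _ _) _.
by rewrite geq_max leqnn andbT (leq_trans (size_polyC_leq1 _)) // ltnW.
Qed.

Lemma size_pet_shift_le (p1 p : {poly R}) (h : nat) :
  (1 < size p1)%N -> size p = size p1 ->
  (size (pet_shift p1 p h) <= size p1)%N.
Proof.
move=> p1_gt1 sp; rewrite /pet_shift.
apply: leq_trans (size_polyD _ _) _; rewrite size_polyN geq_max leqnn andbT.
apply: leq_trans (size_polyD _ _) _; rewrite size_polyN size_shift sp.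
by rewrite geq_max leqnn (leq_trans (size_polyC_leq1 _)) // ltnW.
Qed.

Lemma coef_pet_shift (p1 p : {poly R}) (h : nat) :
  (1 < size p1)%N -> size p = size p1 ->
  (pet_shift p1 p h)`_(size p1).-1 = lead_coef p - lead_coef p1.
Proof.
move=> p1_gt1 sp; rewrite /pet_shift !coefB coefC [_ == 0%N](_ : _ = false).
  rewrite subr0 -[lead_coef p](lead_coef_shift p h%:R) !lead_coefE.
  by rewrite size_shift sp.
by case: (size p1) p1_gt1 => [|[]].
Qed.

(* PET induction: shifting by p1 of minimal degree removes one leading
   coefficient in that degree and keeps the counts in higher degrees. *)
Theorem polynomial_van_der_waerden (F : seq {poly R}) :
  (forall p, p \in F -> p.[0] = 0) -> recurrent F.
Proof.
have [D ltD] : exists D, forall p, p \in F -> (size p < D)%N.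
  exists (\max_(p <- F) size p).+1 => p Fp; rewrite ltnS.
  exact: (@leq_bigmax_seq _ F xpredT (fun p : {poly R} => size p) p).
have [w Ew] : exists w, forall k, lead_count F k = w k by exists (lead_count F).
elim/(@lex_ind D): w F ltD Ew => w IHw F ltD Ew F0.
apply: recurrent_filter; set F1 := [seq p <- F | p != 0].
have F1P p : p \in F1 -> p \in F /\ p != 0.
  by rewrite mem_filter => /andP[].
have [F1e|[p2 F1p2]] : F1 = [::] \/ exists p, p \in F1.
    by case: (F1) => [|p s]; [left | right; exists p; rewrite mem_head].
  by rewrite F1e; apply: recurrent_nil.
have [p1 F1p1 min1] : exists2 p1, p1 \in F1 &
    forall p, p \in F1 -> (size p1 <= size p)%N.
  have ex : exists n, has (fun p : {poly R} => size p == n) F1.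
    by exists (size p2); apply/hasP; exists p2.
  case: (ex_minnP ex) => n /hasP[p1 F1p1 /eqP sp1] min.
  exists p1 => // p F1p; rewrite sp1; apply: min.
  by apply/hasP; exists p.
have [Fp1 p1_neq0] := F1P _ F1p1.
have p1_gt1 : (1 < size p1)%N by apply: size_gt1_root0 => //; apply: F0.
apply: (@recurrent_of_shifts F1 p1) => // [p /F1P[Fp _]|hs]; first exact: F0.
set G := [seq pet_shift p1 p h | p <- F1, h <- hs].
apply: (IHw (lead_count G) (size p1) (ltD _ Fp1)) => // [|k /andP[ltk _]|q|q].
- rewrite -Ew /lead_count.
  have p1F : lead_coef p1 \in
      undup [seq lead_coef p | p : {poly R} <- F & size p == size p1].
    by rewrite mem_undup map_f // mem_filter eqxx.
  set U := undup _ in p1F *; have U_gt0 : (0 < size U)%N by case: (U) p1F.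
  rewrite -(prednK U_gt0) ltnS -(size_rem p1F).
  (* In this size, the leading coefficients of [G] are those of [F] minus [lead_coef p1];
     [lead_coef p1] itself would give 0, hence a smaller degree. *)
  rewrite -[leqRHS](size_map (fun x : R => x - lead_coef p1)).
  apply: uniq_leq_size (undup_uniq _) _ => x; rewrite mem_undup => /mapP[q].
  rewrite mem_filter => /andP[/eqP sq] /allpairsP[[p h]] /= [F1p _ Eq] ->.
  have [Fp p_neq0] := F1P _ F1p.
  have sp : size p = size p1.
    have := min1 _ F1p; rewrite leq_eqVlt => /predU1P[Ep|lt]; first by [].
    by have [] := size_lead_pet_shift h p1_gt1 lt; rewrite -Eq sq.
  have Eqlc : lead_coef q = lead_coef p - lead_coef p1.
    by rewrite lead_coefE sq Eq coef_pet_shift.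
  rewrite Eqlc; apply: (map_f (fun x : R => x - lead_coef p1)).
  rewrite mem_rem_uniq ?undup_uniq // inE -subr_eq0 -Eqlc lead_coef_eq0.
  rewrite -size_poly_eq0 sq mem_undup map_f ?andbT.
    by case: (size p1) p1_gt1.
  by rewrite mem_filter sp eqxx.
- rewrite -Ew; apply: lead_count_sub => q /allpairsP[[p h]] /=.
  case=> F1p _ -> sq; have [Fp p_neq0] := F1P _ F1p.
  have := min1 _ F1p; rewrite leq_eqVlt => /predU1P[Ep|lt].
    by have := size_pet_shift_le h p1_gt1 (esym Ep); rewrite sq leqNgt ltk.
  by have [Es El] := size_lead_pet_shift h p1_gt1 lt; exists p; rewrite // -sq Es.
- move=> /allpairsP[[p h]] /= [F1p _ ->]; have [Fp p_neq0] := F1P _ F1p.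
  have := min1 _ F1p; rewrite leq_eqVlt => /predU1P[Ep|lt].
    exact: leq_ltn_trans (size_pet_shift_le h p1_gt1 (esym Ep)) (ltD _ Fp1).
  by have [-> _] := size_lead_pet_shift h p1_gt1 lt; apply: ltD.
- move=> /allpairsP[[p h]] /= [F1p _ ->]; have [Fp p_neq0] := F1P _ F1p.
  by rewrite horner_pet_shift add0r subrr F0 ?subrr.
Qed.

End PolynomialVanDerWaerden.

(** * Recurrence along several scales in the rationals *)

Lemma coef_monomial_natX (x : rat) (m j k i : nat) :
  ((x *: 'X^j) * m%:R ^+ k)`_i = (x * m%:R ^+ k) *+ (i == j).
Proof.
have -> : m%:R ^+ k = (m ^ k)%:R :> {poly rat} by rewrite natrX.
by rewrite mulr_natr coefMn coefZ coefXn -natrX !mulr_natr mulrnAC.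
Qed.

(* O, d and n do not depend on the coloring, on e or on z: the theorem is applied
   over {poly rat}, where 'X^i stands for the generator e i. *)
Lemma uniform_recurrence (T I A : finType) (k : I -> nat) (a : A -> I -> rat) :
  (forall i, (0 < k i)%N) ->
  exists (O : finType) (d : O -> nat) (n : O -> I -> rat),
    (forall o, (0 < d o)%N) /\ (forall o i, 0 <= n o i) /\
    forall (c : rat -> T) (e : I -> rat) (z : rat), exists o, forall s,
      c (z + \sum_i (n o i + a s i * (d o)%:R ^+ k i) * e i) =
      c (z + \sum_i n o i * e i).
Proof.
move=> k_gt0; pose rk (i : I) : nat := enum_rank i.
pose p (s : A) : {poly {poly rat}} :=
  \sum_i (a s i *: 'X^(rk i))%:P * 'X^(k i).
have p0 s : (p s).[0] = 0.
  rewrite /p horner_sum big1 // => i _.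
  by rewrite hornerM hornerXn expr0n eqn0Ngt k_gt0 mulr0.
have [|O [w [d [d_gt0 Hc]]]] :=
    @polynomial_van_der_waerden _ [seq p s | s <- enum A] _ T.
  by move=> _ /mapP[s _ ->].
(* Adding [B] makes all coefficients nonnegative; the colouring pulled back to polynomials is
   translated accordingly. *)
pose B := \sum_o \sum_i `|(w o)`_(rk i)|.
exists O, d, (fun o i => B + (w o)`_(rk i)); split=> //; split=> [o i|c e z].
  rewrite -lerBlDr sub0r; apply: le_trans (ler_norm _) _; rewrite normrN.
  rewrite /B (bigD1 o) //= (bigD1 i) //= -addrA lerDl addr_ge0 ?sumr_ge0 //.
  by move=> o' _; rewrite sumr_ge0.
pose f (q : {poly rat}) := \sum_i q`_(rk i) * e i.
have [o Ho] := Hc (fun q => c (z + \sum_i B * e i + f q)); exists o => s.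
have -> : z + \sum_i (B + (w o)`_(rk i)) * e i = z + \sum_i B * e i + f (w o).
  by rewrite -addrA -big_split; congr (_ + _); apply: eq_bigr => i _; rewrite mulrDl.
rewrite -(Ho (p s)) ?map_f ?mem_enum //; congr c.
rewrite -!addrA -big_split; congr (_ + _); apply: eq_bigr => i _ /=.
rewrite coefD; suff -> : (p s).[(d o)%:R]`_(rk i) = a s i * (d o)%:R ^+ k i.
  by rewrite !mulrDl addrA.
rewrite /p horner_sum coef_sum (bigD1 i) //= big1 ?addr0 => [|j ji].
  by rewrite hornerM hornerC hornerXn coef_monomial_natX eqxx.
rewrite hornerM hornerC hornerXn coef_monomial_natX.
suff /negPf-> : rk i != rk j by [].
by apply: contra ji => /eqP/ord_inj/enum_rank_inj ->.
Qed.

(* The step to n + 1 handles j = n first, with a new scale d': then d is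
   multiplied by d' and X divided by d' ^ n, and the remaining shifts e j have
   positive degree in d', so that one application of [uniform_recurrence]
   covers all the choices still open for j < n. *)
Lemma multilevel_recurrence (J A T : finType) (t : J -> nat)
    (a : A -> J -> rat) (n : nat) : (forall g, (0 < t g)%N) ->
  exists (O : finType) (d : O -> nat) (X : O -> rat) (v : O -> nat -> J -> rat),
    (forall o, (0 < d o)%N) /\ (forall o, 0 < X o) /\
    (forall o j g, 0 <= v o j g) /\
    forall (C : nat -> rat -> T) (e : nat -> J -> rat) (w : rat), exists o,
      forall y, y = w + \sum_(j < n) \sum_g v o j g * e j g ->
      forall j s, (j < n)%N ->
        C j (X o * (d o)%:R ^+ j * y + \sum_g a s g * (d o)%:R ^+ t g * e j g) =
        C j (X o * (d o)%:R ^+ j * y).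
Proof.
move=> t_gt0; elim: n => [|n [O [d [X [v [d_gt0 [X_gt0 [v_ge0 IH]]]]]]]].
  exists unit, (fun=> 1%N), (fun=> 1), (fun _ _ _ => 0).
  by do !split=> // C e w; exists tt.
pose I := ('I_n.+1 * J)%type.
(* [X * d ^ j] gets divided by the new scale to the power [n - j]; this exponent compensates for
   it. *)
pose k (i : I) := (t i.2 + (n - i.1))%N.
have k_gt0 i : (0 < k i)%N by rewrite addn_gt0 t_gt0.
pose b o (j : nat) g := if (j < n)%N then v o j g else 0.
(* Levels below [n] anticipate the choice of [o]. At level [n], [None] is the unshifted point and
   [Some s] the shifted one, divided by the factor of [y]. *)
pose a' (u : O * option A) (i : I) := if (i.1 < n)%N then v u.1 i.1 i.2 else
  if u.2 is Some s then
    a s i.2 * (d u.1)%:R ^+ t i.2 / (X u.1 * (d u.1)%:R ^+ n) else 0.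
(* A colour records all [o] at once, since [o] is chosen only after [o']. *)
have [O' [d' [v' [d'_gt0 [v'_ge0 Hc]]]]] :=
  @uniform_recurrence {ffun O -> T} I _ k a' k_gt0.
have b_ge0 o j g : 0 <= b o j g by rewrite /b; case: ifP.
exists (O' * O)%type, (fun u => d' u.1 * d u.2)%N.
exists (fun u => X u.2 / (d' u.1)%:R ^+ n).
exists (fun u j g => v' u.1 (inord j, g) +
                     b u.2 j g * (d' u.1)%:R ^+ (t g + (n - j))).
have d'P u : (d' u)%:R != 0 :> rat by rewrite pnatr_eq0 -lt0n.
have dP u : (d u)%:R != 0 :> rat by rewrite pnatr_eq0 -lt0n.
have XP u : X u != 0 by rewrite gt_eqF.
have Epair (F : I -> rat) : \sum_i F i = \sum_(j < n.+1) \sum_g F (j, g).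
  by rewrite pair_bigA; apply: eq_bigr => -[].
split=> [u|]; first by rewrite muln_gt0 d'_gt0 d_gt0.
split=> [u|]; first by rewrite divr_gt0 ?exprn_gt0 ?ltr0n.
split=> [u j g|C e w].
  by rewrite addr_ge0 ?mulr_ge0 ?exprn_ge0 ?ler0n.
have [o' Ho'] := Hc (fun q => [ffun o => C n (X o * (d o)%:R ^+ n * q)])
                    (fun i => e i.1 i.2) w.
set z := w + \sum_i v' o' i * e i.1 i.2 in Ho'.
have [o Ho] := IH (fun j q => C j (q / (d' o')%:R ^+ (n - j)))
  (fun j g => (d' o')%:R ^+ (t g + (n - j)) * e j g) z.
exists (o', o) => y /= Ey j s; rewrite ltnS.
have Ey' : y = z + \sum_(j < n) \sum_g
    v o j g * ((d' o')%:R ^+ (t g + (n - j)) * e j g).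
  rewrite Ey /z -addrA; congr (_ + _).
  rewrite Epair /=.
  under eq_bigr => i _ do
    (under eq_bigr => g _ do rewrite inord_val mulrDl; rewrite big_split).
  rewrite big_split; congr (_ + _).
  rewrite big_ord_recr /= [X in _ + X]big1 ?addr0 => [|g _].
    apply: eq_bigr => i _; apply: eq_bigr => g _.
    by rewrite /b ltn_ord mulrA.
  by rewrite /b ltnn !mul0r.
rewrite leq_eqVlt => /predU1P[->|ltjn]; last first.
  have := Ho y Ey' j s ltjn.
  have E0 : X o * (d o)%:R ^+ j * y / (d' o')%:R ^+ (n - j) =
     X o / (d' o')%:R ^+ n * (d' o' * d o)%:R ^+ j * y.
    rewrite -(subnKC (ltnW ltjn)) exprD addKn natrM exprMn.
    have := d'P o'; set x := (d' o')%:R => x0.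
    by field; rewrite !expf_neq0.
  rewrite mulrDl E0 => <-; congr (C j (_ + _)).
  rewrite mulr_suml; apply: eq_bigr => g _.
  rewrite exprD natrM exprMn.
  have := d'P o'; set x := (d' o')%:R => x0.
  by field; rewrite expf_neq0.
have E1 : X o / (d' o')%:R ^+ n * (d' o' * d o)%:R ^+ n = X o * (d o)%:R ^+ n.
  by rewrite natrM exprMn; field; rewrite expf_neq0.
rewrite /= E1; set K := X o * (d o)%:R ^+ n in E1 *.
have K0 : K != 0 by rewrite mulf_neq0 ?expf_neq0.
(* The shifted and the unshifted point both have the colour of the base point [z]. *)
have /ffunP/(_ o) := Ho' (o, Some s); have /ffunP/(_ o) := Ho' (o, None).
rewrite !ffunE -/K => EN ES.
suff [<- <-] : K * (w + \sum_i (v' o' i + a' (o, Some s) i * (d' o')%:R ^+ k i) * e i.1 i.2) =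
    K * y + \sum_g a s g * (d' o' * d o)%:R ^+ t g * e n g /\
    K * (w + \sum_i (v' o' i + a' (o, None) i * (d' o')%:R ^+ k i) * e i.1 i.2) = K * y.
  by rewrite ES EN.
have EyN : y = w + \sum_i (v' o' i + a' (o, None) i * (d' o')%:R ^+ k i) * e i.1 i.2.
  rewrite Ey Epair; congr (_ + _); apply: eq_bigr => i _; apply: eq_bigr => g _ /=.
  by rewrite inord_val.
split; last by rewrite -EyN.
have -> : w + \sum_i (v' o' i + a' (o, Some s) i * (d' o')%:R ^+ k i) * e i.1 i.2 =
    y + \sum_g a s g * (d o)%:R ^+ t g / K * (d' o')%:R ^+ t g * e n g.
  rewrite EyN !Epair !big_ord_recr /= -!addrA -big_split /=; congr (_ + (_ + _)).
    apply: eq_bigr => i _; apply: eq_bigr => g _.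
    by rewrite /a' /= ltn_ord.
  apply: eq_bigr => g _; rewrite /a' /k /= ltnn subnn addn0 mul0r addr0 mulrDl.
  by rewrite -/K.
rewrite mulrDr mulr_sumr; congr (_ + _); apply: eq_bigr => g _.
by rewrite natrM exprMn; field.
Qed.

(** * Sequences in which the largest index determines the colour *)

Definition max_determined (T : Type) (C : rat -> T) (N : nat)
    (x : nat -> rat) : Prop :=
  forall n (P : {set 'I_n}) (G : {set {set 'I_n}}), (n < N)%N -> set0 \notin G ->
    C (x n * \prod_(i in P) x i + \sum_(J in G) \prod_(i in J) x i) =
    C (x n * \prod_(i in P) x i).

Lemma eq_max_determined (T : Type) (C : rat -> T) (N : nat) (x y : nat -> rat) :
  (forall i, (i < N)%N -> x i = y i) ->
  max_determined C N x -> max_determined C N y.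
Proof.
move=> xy Hx n P G ltn G0; have := Hx n P G ltn G0.
have prodE (Q : {set 'I_n}) : \prod_(i in Q) x i = \prod_(i in Q) y i.
  by apply: eq_bigr => i _; rewrite xy // (ltn_trans (ltn_ord i)).
by rewrite xy // prodE (eq_bigr _ (fun J _ => prodE J)).
Qed.

Lemma prod_scale (I : finType) (P : {set I}) (a : rat) (x : I -> rat) :
  \prod_(i in P) (a * x i) = a ^+ #|P| * \prod_(i in P) x i.
Proof. by rewrite big_split prodr_const. Qed.

(** A new term rescales the old ones by a [d] known only after they are chosen, so the induction
    carries a finite family [D] of rescalings. *)
Theorem max_determined_exists (T S : finType) (D : S -> rat) (C : rat -> T)
    (N : nat) :
  (forall s, 0 < D s) ->
  exists x : nat -> rat, (forall i, 0 < x i) /\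
    forall s, max_determined C N (fun i => D s * x i).
Proof.
elim: N S D => [|N IH] S D D_gt0; first by exists (fun=> 1); split.
pose U := (S * {set 'I_N})%type.
(* Exponents must be positive; [maxn] alters only that of the empty set, which [G] excludes. *)
pose t (g : U * {set 'I_N}) := maxn 1 #|g.2|.
pose a (s : U * {set {set 'I_N}}) (g : U * {set 'I_N}) : rat :=
  ((g.1 == s.1) && (g.2 \in s.2))%:R.
have t_gt0 g : (0 < t g)%N by rewrite leq_maxl.
have [O [d [X [v [d_gt0 [X_gt0 [v_ge0 HB]]]]]]] :=
  @multilevel_recurrence _ _ {ffun U -> T} t a N.+1 t_gt0.
have [|x [x_gt0 Hx]] := IH (S * O)%type (fun u => D u.1 * (d u.2)%:R).
  by move=> u; rewrite mulr_gt0 ?ltr0n.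
(* The part of the leading product that depends on neither [d] nor the new term. The generators [e]
   are divided by it because the colourings multiply by it. *)
pose K (u : U) := D u.1 ^+ #|u.2|.+1 * \prod_(i in u.2) x i.
have K_gt0 u : 0 < K u by rewrite mulr_gt0 ?exprn_gt0 ?prodr_gt0.
pose e (g : U * {set 'I_N}) := \prod_(i in g.2) (D g.1.1 * x i) / K g.1.
(* Level [j] serves the leading products with [#|P| = j]; the base point [1] makes [y] positive. *)
have [o Ho] := HB (fun _ q => [ffun u => C (K u * q)]) (fun=> e) 1.
set y := 1 + _ in Ho; have {}Ho := Ho y erefl.
have y_gt0 : 0 < y.
  rewrite ltr_pwDl ?sumr_ge0 // => j _; rewrite sumr_ge0 // => g _.
  rewrite mulr_ge0 // divr_ge0 ?ltW // prodr_gt0 // => i _.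
  by rewrite mulr_gt0.
exists (fun i => if (i < N)%N then (d o)%:R * x i else X o * y).
split=> [i|s n P G]; first by case: ifP => _; rewrite mulr_gt0 ?ltr0n.
rewrite ltnS leq_eqVlt => /predU1P[En|ltn] G0; last first.
  suff /(_ n P G ltn G0) : max_determined C N (fun i => D s *
    (if (i < N)%N then (d o)%:R * x i else X o * y)) by [].
  by apply: eq_max_determined (Hx (s, o)) => i /= ->; rewrite mulrA.
move: P G G0; rewrite En => P G G0; rewrite ltnn.
have prodE (J : {set 'I_N}) :
    \prod_(i in J) (D s * (if (i < N)%N then (d o)%:R * x i else X o * y)) =
    (d o)%:R ^+ #|J| * \prod_(i in J) (D s * x i).
  by rewrite -prod_scale; apply: eq_bigr => i _; rewrite ltn_ord mulrCA.
have leadE : D s * (X o * y) * ((d o)%:R ^+ #|P| * \prod_(i in P) (D s * x i)) =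
    K (s, P) * (X o * (d o)%:R ^+ #|P| * y).
  by rewrite prod_scale /K /= exprS; ring.
rewrite prodE (eq_bigr _ (fun J _ => prodE J)) leadE.
have ltP : (#|P| < N.+1)%N by rewrite ltnS -[N in (_ <= N)%N]card_ord max_card.
have /ffunP/(_ (s, P)) := Ho #|P| ((s, P), G) ltP; rewrite !ffunE => <-.
congr C; rewrite [RHS]mulrDr; congr (_ + _).
rewrite -(pair_bigA _ (fun u J => a ((s, P), G) (u, J) *
  (d o)%:R ^+ t (u, J) * e (u, J))) /=.
rewrite (bigD1 (s, P)) //= [X in _ + X]big1 ?addr0 => [|u us]; last first.
  by apply: big1 => J _; rewrite /a /= (negPf us) !mul0r.
rewrite mulr_sumr [LHS]big_mkcond; apply: eq_bigr => J _.
rewrite /a /t /e /= eqxx /=; case: ifP => JG; last by rewrite !mul0r mulr0.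
rewrite (maxn_idPr _) ?card_gt0; last by apply: contraNneq G0 => <-.
by rewrite mul1r; have := lt0r_neq0 (K_gt0 (s, P)) => K0; field.
Qed.

(** * The Hales-Jewett theorem *)

Section HalesJewett.

Variable L : finType.

(* A variable word is a word over [option L], with [None] as the variable. *)
Definition subst (a : L) (v : seq (option L)) : seq L := map (odflt a) v.

Lemma subst_cat a v w : subst a (v ++ w) = subst a v ++ subst a w.
Proof. exact: map_cat. Qed.

Lemma subst_Some a u : subst a (map Some u) = u.
Proof. by rewrite /subst -map_comp map_id. Qed.

(** Words range over all of [L] but only letters of [A] are substituted, so [A] can grow one letter
    at a time. *)
Definition hales_jewett_for (A : seq L) : Prop :=
  forall T : finType, exists n, forall c : seq L -> T,
  exists v, [/\ size v = n, None \in v &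
    {in A &, forall a b, c (subst a v) = c (subst b v)}].

(** Colour focusing: a block in which the letters of [A] are indistinguishable is put in front, and
    substituting [a] in it gives the new focus. *)
Lemma line_focusing (a a0 : L) (A : seq L) (T : finType) (s : nat) :
  a0 \in A -> hales_jewett_for A ->
  exists n, forall c : seq L -> T,
    (exists v, [/\ size v = n, None \in v &
       {in a :: A &, forall a b, c (subst a v) = c (subst b v)}]) \/
    exists (f : seq L) (vs : seq (seq (option L))),
      [/\ size f = n, size vs = s,
          forall v, v \in vs -> [/\ size v = n, None \in v, subst a v = f &
            {in A, forall b, c (subst b v) = c (subst a0 v)}]
        & uniq (c f :: [seq c (subst a0 v) | v <- vs])].
Proof.
move=> Aa0 HA; elim: s => [|s [n IH]].
  by exists 0%N => c; right; exists [::], [::].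
have [n' Hn'] := HA {ffun n.-tuple L -> T}.
exists (n' + n)%N => c.
have [v0 [sv0 v0N Hv0]] := Hn' (fun u => [ffun w : n.-tuple L => c (u ++ w)]).
have block b w : b \in A -> size w = n ->
    c (subst b v0 ++ w) = c (subst a0 v0 ++ w).
  move=> Ab /eqP sw; have /ffunP/(_ (Tuple sw)) := Hv0 b a0 Ab Aa0.
  by rewrite !ffunE.
have [[v [sv vN Hv]]|[f [vs [sf svs Hvs un]]]] := IH (fun w => c (subst a0 v0 ++ w)).
  left; exists (map Some (subst a0 v0) ++ v); split=> [||b b' Ab Ab'].
  - by rewrite size_cat !size_map sv0 sv.
  - by rewrite mem_cat vN orbT.
  - by rewrite !subst_cat !subst_Some; apply: Hv.
(* The old focus, as a constant word, becomes a line once [v0] precedes it. *)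
pose ws := map Some f :: vs.
have wsP w : w \in ws -> [/\ size w = n, subst a w = f &
    {in A, forall b, c (subst a0 v0 ++ subst b w) = c (subst a0 v0 ++ subst a0 w)}].
  rewrite inE => /predU1P[->|/Hvs[sw _ Ew Hw]]; last by split.
  by rewrite size_map sf; split=> // [|b _]; rewrite !subst_Some.
have lineP w b : w \in ws -> b \in A ->
    c (subst b (v0 ++ w)) = c (subst a0 v0 ++ subst a0 w).
  move=> /wsP[sw _ Hw] Ab; rewrite subst_cat block ?Hw //.
  by rewrite size_map.
have aP w : w \in ws -> subst a (v0 ++ w) = subst a v0 ++ f.
  by move=> /wsP[_ Ew _]; rewrite subst_cat Ew.
have [/mapP[w wsw Ew]|cn] := boolP (c (subst a v0 ++ f) \in
    [seq c (subst a0 v0 ++ subst a0 w) | w <- ws]).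
  left; exists (v0 ++ w); have [sw _ _] := wsP w wsw.
  split=> [||b b']; first by rewrite size_cat sv0 sw.
    by rewrite mem_cat v0N.
  have colP d : d \in a :: A ->
      c (subst d (v0 ++ w)) = c (subst a0 v0 ++ subst a0 w).
    by rewrite inE => /predU1P[->|Ad]; rewrite ?aP ?lineP.
  by move=> /colP -> /colP ->.
right; exists (subst a v0 ++ f), [seq v0 ++ w | w <- ws]; split.
- by rewrite size_cat size_map sv0 sf.
- by rewrite size_map /= svs.
- move=> _ /mapP[w wsw ->]; have [sw _ _] := wsP w wsw; split.
  + by rewrite size_cat sv0 sw.
  + by rewrite mem_cat v0N.
  + exact: aP.
  + by move=> b Ab; rewrite !lineP.
- have -> : [seq c (subst a0 w) | w <- [seq v0 ++ w | w <- ws]] =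
      [seq c (subst a0 v0 ++ subst a0 w) | w <- ws].
    by rewrite -map_comp; apply/eq_in_map => w wsw /=; rewrite lineP.
  by rewrite cons_uniq cn /= subst_Some.
Qed.

(** Focusing [#|T|] lines at one word would use [#|T| + 1] colours. Lists of at most one letter are
    treated apart, as focusing needs a letter [a0]. *)
Theorem hales_jewett (A : seq L) : hales_jewett_for A.
Proof.
elim: A => [|a [_|a0 A IH]] T.
- by exists 1%N => c; exists [:: None]; split.
- by exists 1%N => c; exists [:: None]; split=> // b b'; rewrite !inE => /eqP-> /eqP->.
have [n Hn] := line_focusing a T #|T| (mem_head a0 A) IH.
exists n => c; have [//|[f [vs [_ svs _ un]]]] := Hn c.
have := max_card (mem (c f :: [seq c (subst a0 v) | v <- vs])).
by rewrite (card_uniqP un) /= size_map svs ltnn.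
Qed.

End HalesJewett.

(** * Finite unions *)

Lemma finite_unions (T : finType) (k : nat) :
  exists U : finType, forall c : {set U} -> T, exists D : nat -> {set U},
    [/\ forall i, (i < k)%N -> D i != set0,
        forall i j, (i < j)%N -> (j < k)%N -> [disjoint D i & D j]
      & forall j (I : {set 'I_j}), (j < k)%N ->
          c (D j :|: \bigcup_(i in I) D i) = c (D j)].
Proof.
elim: k => [|k [U IH]]; first by exists unit => c; exists (fun=> set0).
(* A word of sets is a subset of [n] copies of [U]. Substituting [Q] for [set0] adds a copy of [Q]
   at each variable position and keeps the colour. *)
have [n Hn] := @hales_jewett {set U} (enum {set U}) T.
exists (option ('I_n * U)) => c.
(* The extra point [None] lies in every [word], so [B] is nonempty. *)
pose word (w : seq {set U}) : {set option ('I_n * U)} :=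
  [set z : option ('I_n * U) | if z is Some (i, u) then u \in nth set0 w i else true].
have [v [sv vN Hv]] := Hn (fun w => c (word w)).
pose copy (Q : {set U}) : {set option ('I_n * U)} :=
  [set z : option ('I_n * U) | if z is Some (i, u) then (nth (Some set0) v i == None) && (u \in Q)
           else false].
pose B := word (subst set0 v).
have wordE Q : word (subst Q v) = B :|: copy Q.
  apply/setP=> -[[i u]|]; rewrite !inE // !(nth_map (Some set0)) ?sv //.
  by case: (nth _ _ _) => [P|] /=; rewrite ?inE ?orbF.
have Hc Q : c (B :|: copy Q) = c B.
  by rewrite -wordE; apply: Hv; rewrite mem_enum.
have copyU Q Q' : copy (Q :|: Q') = copy Q :|: copy Q'.
  by apply/setP=> -[[i u]|]; rewrite !inE // andb_orr.
have copy0 : copy set0 = set0.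
  by apply/setP=> -[[i u]|]; rewrite !inE // andbF.
have copy_bigcup (I : finType) (P : {set I}) (E : I -> {set U}) :
    copy (\bigcup_(i in P) E i) = \bigcup_(i in P) copy (E i).
  exact: (big_morph copy copyU copy0).
have [D [D_neq0 D_disj HD]] := IH (fun Q => c (copy Q)).
exists (fun i => if (i < k)%N then copy (D i) else B); split=> [i|i j|j I].
- rewrite ltnS => leik; case: ifP => [lti|_]; last first.
    by apply/set0Pn; exists None; rewrite inE.
  have /set0Pn[u Du] := D_neq0 i lti.
  have lti0 : (index None v < n)%N by rewrite -sv index_mem.
  apply/set0Pn; exists (Some (Ordinal lti0, u)).
  by rewrite inE /= nth_index // Du.
- move=> ltij; rewrite ltnS leq_eqVlt => /predU1P[Ej|ltj].
    rewrite Ej ltnn -Ej ltij -setI_eq0; apply/eqP/setP=> -[[l u]|]; last by rewrite !inE.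
    rewrite !inE (nth_map (Some set0)) ?sv //.
    by case: (nth _ _ _) => //=; rewrite inE andbF.
  rewrite ltj (ltn_trans ltij ltj) -setI_eq0.
  have /pred0P dis := D_disj i j ltij ltj.
  apply/eqP/setP=> -[[l u]|]; rewrite !inE //.
  have := dis u; rewrite /= => dis_u.
  by case: (nth _ _ _) => //=.
- have copyE : (j <= k)%N -> \bigcup_(i in I) (if (i < k)%N then copy (D i) else B) =
      copy (\bigcup_(i in I) D i).
    move=> lejk; rewrite copy_bigcup; apply: eq_bigr => i _.
    by rewrite (leq_trans (ltn_ord i)).
  rewrite ltnS => lejk; rewrite copyE //.
  case: ifP => [ltj|_]; last exact: Hc.
  by rewrite -copyU HD.
Qed.

(** * From sums of disjoint products to a single product *)

Section ColourOfSums.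

Variables (T : Type) (C : rat -> T) (U : finType) (x : nat -> rat).
Hypothesis Cx : max_determined C #|U| x.

Let rk (u : U) : nat := enum_rank u.

(** The summand containing the element of largest rank is the leading product of [max_determined];
    the others, of smaller rank, form [G]. *)
Lemma colour_of_sum (l : nat) (E : 'I_l -> {set U}) :
  (0 < l)%N -> (forall j, E j != set0) ->
  (forall i j, i != j -> [disjoint E i & E j]) ->
  exists j, C (\sum_j \prod_(u in E j) x (rk u)) = C (\prod_(u in E j) x (rk u)).
Proof.
move=> l_gt0 E_neq0 E_disj.
have /set0Pn[u1 Eu1] := E_neq0 (Ordinal l_gt0).
have [u0 Eu0 max_u0] : exists2 u0, u0 \in \bigcup_j E j &
    forall u, u \in \bigcup_j E j -> (rk u <= rk u0)%N.
  have Eu1' : u1 \in \bigcup_j E j by apply/bigcupP; exists (Ordinal l_gt0).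
  by case: (arg_maxnP rk Eu1') => u0 Eu0 max; exists u0.
have /bigcupP[j0 _ Ej0] := Eu0; exists j0; set n := rk u0.
have rk_lt u : u \in \bigcup_j E j -> u != u0 -> (rk u < n)%N.
  move=> /max_u0; rewrite leq_eqVlt => /predU1P[/ord_inj/enum_rank_inj ->|//].
  by rewrite eqxx.
have ltn : (n < #|U|)%N := ltn_ord _.
pose h (i : 'I_n) : U := enum_val (widen_ord (ltnW ltn) i).
have h_inj : injective h.
  by move=> i j /enum_val_inj Eij; apply: ord_inj; exact: (congr1 val Eij).
have rkh i : rk (h i) = i by rewrite /rk /h enum_valK.
have prodE (Q : {set U}) : (forall u, u \in Q -> (rk u < n)%N) ->
    \prod_(u in Q) x (rk u) = \prod_(i in h @^-1: Q) x i.
  move=> Qlt; have {1}-> : Q = h @: (h @^-1: Q).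
    apply/setP=> u; apply/idP/imsetP => [Qu|[i + ->]]; last by rewrite inE.
    have hu : h (Ordinal (Qlt u Qu)) = u.
      by rewrite -[RHS]enum_rankK; congr enum_val; apply: val_inj.
    by exists (Ordinal (Qlt u Qu)); rewrite ?inE hu.
  rewrite big_imset /=; last by move=> i j _ _ /h_inj.
  by apply: eq_bigr => i _; rewrite rkh.
have E_lt j : j != j0 -> forall u, u \in E j -> (rk u < n)%N.
  move=> jj0 u Eju; apply: rk_lt; first by apply/bigcupP; exists j.
  apply: contraTneq Eju => ->; apply/negP => Eju0.
  by have /pred0P/(_ u0) := E_disj j j0 jj0; rewrite /= Eju0 Ej0.
have lead : \prod_(u in E j0) x (rk u) =
    x n * \prod_(i in h @^-1: (E j0 :\ u0)) x i.
  rewrite (big_setD1 u0) //= prodE // => u; rewrite !inE => /andP[uu0 Eu].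
  by apply: rk_lt => //; apply/bigcupP; exists j0.
pose G := [set h @^-1: E j | j in [set~ j0]].
have G_neq0 j : j != j0 -> h @^-1: E j != set0.
  move=> jj0; have /set0Pn[u Eju] := E_neq0 j; have ltu := E_lt j jj0 u Eju.
  apply/set0Pn; exists (Ordinal ltu); rewrite inE.
  suff -> : h (Ordinal ltu) = u by [].
  by rewrite -[RHS]enum_rankK; congr enum_val; apply: val_inj.
have G0 : set0 \notin G.
  by apply/imsetP => -[j]; rewrite !inE => /G_neq0 + /esym /eqP => /negPf ->.
have := Cx (h @^-1: (E j0 :\ u0)) ltn G0; rewrite -lead => <-; congr C.
rewrite (bigD1 j0) //=; congr (_ + _); rewrite big_imset /=.
  under [RHS]eq_bigl do rewrite !inE.
  by apply: eq_bigr => j jj0; rewrite prodE //; apply: E_lt.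
(* Nonempty disjoint sets are distinct, so [G] has one member for each index. *)
move=> i j; rewrite !inE => ii0 _ Eij; apply/eqP; apply: contraT => ij.
have /set0Pn[m mi] := G_neq0 i ii0; have mj := mi; rewrite Eij in mj.
have /pred0P/(_ (h m)) := E_disj i j ij; rewrite !inE in mi mj.
by rewrite /= mi mj.
Qed.

End ColourOfSums.

(** * Choice of the blocks by pigeonhole *)

Theorem theorem1p3 (r k : nat) (hr : (0 < r)%N) (hk : (0 < k)%N)
    (C : posrat -> 'I_r) :
  exists x : 'I_k -> posrat, monochromatic C (sums_of_disjoint_products x).
Proof.
(* Nonpositive rationals get an arbitrary colour. *)
pose Cq (q : rat) : 'I_r := if insub q is Some p then C p else Ordinal hr.
have CqE p : Cq (val p) = C p by rewrite /Cq valK.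
(* Among [r * k] blocks, some [k] have products of one colour. *)
have [U HU] := finite_unions 'I_r (r * k).
have [t [t_gt0 Ht]] :=
  @max_determined_exists 'I_r unit (fun=> 1) Cq #|U| (fun=> ltr01).
have {}Ht : max_determined Cq #|U| t.
  by apply: eq_max_determined (Ht tt) => i _; rewrite mul1r.
pose prd (Q : {set U}) := \prod_(u in Q) t (enum_rank u).
have [D [D_neq0 D_disj HD]] := HU (fun Q => Cq (prd Q)).
have [c lec] : exists c, (k <= #|[set j : 'I_(r * k) | Cq (prd (D j)) == c]|)%N.
  apply/existsP; apply: contraT => /existsPn lt.
  have : (#|'I_(r * k)| <= \sum_(c < r) (k.-1))%N.
    rewrite -sum1_card (partition_big (fun j : 'I_(r * k) => Cq (prd (D j))) xpredT) //=.
    apply: leq_sum => c _; rewrite -ltnS prednK // ltnNge.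
    by rewrite sum1dep_card; apply: lt.
  by rewrite sum_nat_const !card_ord leq_pmul2l // leqNgt prednK // leqnn.
pose f (i : 'I_k) : 'I_(r * k) := enum_val (widen_ord lec i).
have f_inj : injective f.
  by move=> i j /enum_val_inj Eij; apply: ord_inj; exact: (congr1 val Eij).
have fP i : Cq (prd (D (f i))) = c.
  by have := enum_valP (widen_ord lec i); rewrite inE => /eqP.
have prd_gt0 Q : 0 < prd Q by apply: prodr_gt0.
have Df_disj i j : i != j -> [disjoint D (f i) & D (f j)].
  rewrite -(inj_eq f_inj) neq_ltn => /orP[] lt; last rewrite disjoint_sym.
    exact: D_disj.
  exact: D_disj.
exists (fun i => Sub (prd (D (f i))) (prd_gt0 _)), c => q [l [I [l_gt0 I_neq0 I_disj qE]]].
pose E j := \bigcup_(i in I j) D (f i).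
have E_neq0 j : E j != set0.
  have /set0Pn[i Iji] := I_neq0 j; have /set0Pn[u Du] := D_neq0 (f i) (ltn_ord _).
  by apply/set0Pn; exists u; apply/bigcupP; exists i.
have E_disj i j : i != j -> [disjoint E i & E j].
  move=> ij; apply/pred0P => u; apply/negP => /andP[/bigcupP[a Ia Du] /bigcupP[b Ib Du']].
  have ab : a != b.
    by apply: contraTneq Ib => <-; have /pred0P/(_ a) := I_disj i j ij; rewrite /= Ia /= => ->.
  by have /pred0P/(_ u) := Df_disj a b ab; rewrite /= Du Du'.
have prdE j : \prod_(i in I j) prd (D (f i)) = prd (E j).
  rewrite /prd [E j](_ : _ = \bigcup_i if i \in I j then D (f i) else set0).
    rewrite partition_disjoint_bigcup /= => [|a b ab].
      rewrite big_mkcond; apply: eq_bigr => i _.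
      by case: ifP => // _; rewrite big_set0.
    case: ifP => _; last by rewrite disjoints_subset sub0set.
    case: ifP => _; first exact: Df_disj.
    by rewrite disjoint_sym disjoints_subset sub0set.
  by rewrite /E big_mkcond.
(* In a union of chosen blocks, the block of largest index fixes the colour, which is [c]. *)
have ECq j : Cq (prd (E j)) = c.
  have /set0Pn[i0 Ii0] := I_neq0 j.
  case: (arg_maxnP (fun i => val (f i)) Ii0) => m Im max_m.
  pose I' := [set a : 'I_(f m) | [exists i in I j, val (f i) == a]].
  have -> : E j = D (f m) :|: \bigcup_(a in I') D a.
    apply/setP => u; rewrite inE; apply/bigcupP/orP => [[i Ii Du]|].
      have : (f i <= f m)%N := max_m i Ii.
      rewrite leq_eqVlt => /predU1P[Efi|lt].
        by left; rewrite -Efi.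
      right; apply/bigcupP; exists (Ordinal lt) => //; rewrite inE.
      by apply/existsP; exists i; rewrite Ii eqxx.
    case=> [Du|/bigcupP[a]]; first by exists m.
    by rewrite inE => /existsP[i /andP[Ii /eqP Ei]] Du; exists i; rewrite ?Ei.
  by rewrite (HD (f m)) // fP.
rewrite -CqE qE /block_sum /=; under eq_bigr => j _ do rewrite prdE.
have [j ->] := colour_of_sum Ht l_gt0 E_neq0 E_disj.
exact: ECq.
Qed.
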